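(* Let $A$ be an integral domain with the $t$-finite character. Then each $t$-locally $t$-finite $t$-ideal of $A$ is $t$-finite.
   Context: Let $A$ be an integral domain with quotient field $K$. ''Ideal'' means integral ideal. For a nonzero fractional ideal $I$, $I^{-1}=(A:I)=\{x\in K: xI\subseteq A\}$, $I^v=(I^{-1})^{-1}$, and $I^t=\bigcup\{J^v: J\subseteq I,\ J \text{ nonzero finitely generated}\}$. $I$ is a $t$-ideal if $I^t=I$ ($t$-ideals are nonzero by definition); $I$ is $t$-finite if there is a finitely generated $J$ with $J^t=I^t$. $t\text{-}\mathrm{Max}(A)$ is the set of $t$-maximal ideals, i.e. the maximal elements of the set of proper (nonzero, integral) $t$-ideals; they are prime. $A$ has the $t$-finite character if each nonzero element of $A$ is contained in only finitely many $t$-maximal ideals. An ideal $I$ is $t$-locally $t$-finite if for every $\mathfrak m\in t\text{-}\mathrm{Max}(A)$ the ideal $IA_{\mathfrak m}$ is $t$-finite with respect to the $t$-operation of $A_{\mathfrak m}$. *)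

(* Defs.v *)
From HB Require Import structures.
From mathcomp Require Import all_boot all_order all_algebra.
From mathcomp Require Import mathcomp_extra boolp classical_sets functions cardinality.

Set Implicit Arguments.
Unset Strict Implicit.
Unset Printing Implicit Defensive.

Import GRing.Theory.

Local Open Scope classical_set_scope.
Local Open Scope ring_scope.

(* An integral domain and its localizations are all handled as subrings D of
   one field K, their common quotient field; ideals and fractional ideals of D
   are then subsets of K.  The definitions below make sense for any set D, but
   they have their intended meaning when D is a subring of K whose quotient
   field is K. *)

Section TOperation.
Variables (K : fieldType) (D : set K).
Implicit Types (I J M N S : set K).

Definition span S : set K :=
  [set x | exists (n : nat) (c s : 'I_n -> K),
     [/\ forall i, D (c i), forall i, S (s i) & x = \sum_(i < n) c i * s i]].

(* A finitely generated D-submodule of K is a fractional ideal because K is the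
   quotient field of D. *)
Definition finitely_generated J : Prop :=
  exists2 S : set K, finite_set S & J = span S.

Definition nonzero I : Prop := exists2 x, I x & x != 0.

Definition is_ideal I : Prop :=
  [/\ I `<=` D, I 0,
      forall x y, I x -> I y -> I (x + y) &
      forall a x, D a -> I x -> I (a * x)].

Definition inv_frac I : set K := [set x | forall y, I y -> D (x * y)].

Definition v_op I : set K := inv_frac (inv_frac I).

Definition t_op I : set K :=
  [set x | exists J, [/\ finitely_generated J, nonzero J, J `<=` I & v_op J x]].

Definition t_ideal I : Prop := [/\ is_ideal I, nonzero I & t_op I = I].

Definition t_finite I : Prop :=
  exists J, [/\ finitely_generated J, nonzero J & t_op J = t_op I].

Definition t_maximal M : Prop :=
  [/\ t_ideal M, M <> D &
      forall N, t_ideal N -> N <> D -> M `<=` N -> N = M].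

Definition t_finite_character : Prop :=
  forall x, D x -> x != 0 -> finite_set [set M | t_maximal M /\ M x].

Definition localization (P : set K) : set K :=
  [set x | exists a s, [/\ D a, D s, ~ P s & x = a / s]].

End TOperation.

(* span (localization D M) I is the extension of I to the localization at M,
   and t_finite is taken with respect to the t-operation of that ring. *)
Definition t_locally_t_finite (K : fieldType) (D I : set K) : Prop :=
  forall M, t_maximal D M ->
    t_finite (localization D M) (span (localization D M) I).

Definition in_frac (A : idomainType) : set {fraction A} :=
  range (@tofrac A).
Arguments in_frac A x : clear implicits.

(* Main.v *)
Require Import Defs.
From mathcomp Require Import all_boot all_order all_algebra.
From mathcomp Require Import boolp classical_sets functions cardinality.

Set Implicit Arguments.
Unset Strict Implicit.
Unset Printing Implicit Defensive.

Import GRing.Theory Defs.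

Local Open Scope classical_set_scope.
Local Open Scope ring_scope.

(** Only finitely many t-maximal ideals M contain a fixed nonzero a in I.  For
    each of them t-finiteness of I A_M provides a finite set F_M included in I
    such that I is contained in the v-closure of F_M A_M.  Let F consist of a
    and of all the F_M.  If y F is contained in A, then y I is contained in every
    A_M: for a in M because of F_M, and for a not in M because y = (y a) / a.
    Since A is the intersection of the A_M, this gives (A : F) = (A : I), so that
    I is the v-closure of the finitely generated ideal F A. *)

(** * Subrings, submodules and finite subsets *)

Definition is_subring (K : fieldType) (L : set K) : Prop :=
  [/\ L 0, L 1, forall x y, L x -> L y -> L (x + y) &
      forall x y, L x -> L y -> L (x * y)].

Definition is_submodule (K : fieldType) (L N : set K) : Prop :=
  [/\ N 0, forall x y, N x -> N y -> N (x + y) &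
      forall c x, L c -> N x -> N (c * x)].

(** Choose one set for each [s] and take the union: it is finite because [S] is, and monotonicity of
    [P] makes it serve every [s]. Below, [S] is either a finite set of elements of [K] or the set of
    t-maximal ideals containing a given element. *)
Lemma finite_subset_uniform (T U : Type) (S : set T) (I : set U)
    (P : T -> set U -> Prop) :
  finite_set S ->
  (forall s F F', F `<=` F' -> P s F -> P s F') ->
  (forall s, S s -> exists F, [/\ finite_set F, F `<=` I & P s F]) ->
  exists F, [/\ finite_set F, F `<=` I & forall s, S s -> P s F].
Proof.
move=> finS monoP exF.
have /choice[G GP] s : exists F, S s -> [/\ finite_set F, F `<=` I & P s F].
  have [Ss|nSs] := pselect (S s); last by exists set0.
  by have [F FP] := exF s Ss; exists F.
exists (\bigcup_(s in S) G s); split.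
- by apply: bigcup_finite => // s /GP[].
- by move=> x [s /GP[_ GI _]] /GI.
- move=> s Ss; have [_ _ Ps] := GP s Ss.
  by apply: monoP Ps; exact: bigcup_sup.
Qed.

(** With this, closure under v-closures of finite subsets passes to the union of a chain, which
    Zorn's lemma for t-ideals requires. *)
Lemma finite_sub_chain (T : choiceType) (C : set (set T)) (F : set T) :
  total_on C subset -> C !=set0 -> finite_set F ->
  F `<=` \bigcup_(X in C) X -> exists2 X, C X & F `<=` X.
Proof.
move=> totC [X0 CX0] /finite_seqP[s ->{F}].
elim: s => [_|x s IHs sC]; first by exists X0.
have [X CX sX] : exists2 X, C X & [set` s] `<=` X.
  by apply: IHs => y sy; apply: sC; rewrite /= inE sy orbT.
have [|Y CY Yx] := sC x; first by rewrite /= inE eqxx.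
have [XY|YX] := totC X Y CX CY.
  by exists Y => // y /=; rewrite inE => /predU1P[->//|/sX/XY].
by exists X => // y /=; rewrite inE => /predU1P[->|/sX//]; exact: YX.
Qed.

(** * The v- and t-operations, computed on finite sets *)

Section DivisorialClosure.
Variables (K : fieldType) (L : set K).
Implicit Types I J N F : set K.

Lemma v_op_mono I J : I `<=` J -> v_op L I `<=` v_op L J.
Proof. by move=> IJ x Ix y Jy; apply: Ix => z /IJ; exact: Jy. Qed.

Lemma t_op_mono I J : I `<=` J -> t_op L I `<=` t_op L J.
Proof.
move=> IJ x [F [fgF nzF FI Fx]]; exists F; split=> //.
exact: subset_trans FI IJ.
Qed.

Lemma sub_v_op I : I `<=` v_op L I.
Proof. by move=> x Ix y; rewrite mulrC; exact. Qed.

Lemma v_op_min I J : I `<=` v_op L J -> v_op L I `<=` v_op L J.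
Proof. by move=> IJ x Ix y Jy; apply: Ix => z /IJ zv; rewrite mulrC; exact: zv. Qed.

(** Multiplication by [c] also carries [inv_frac L J] into [inv_frac L I]. *)
Lemma v_opZ I J c : (forall y, I y -> J (y * c)) ->
  forall x, v_op L I x -> v_op L J (x * c).
Proof.
move=> IJ x Ix y Jy; rewrite -mulrA; apply: Ix => z Iz.
by rewrite mulrAC mulrC [c * z]mulrC; apply/Jy/IJ.
Qed.

Hypothesis ringL : is_subring L.

Lemma subring_submodule : is_submodule L L.
Proof. by have [] := ringL. Qed.

Lemma sub_span F : F `<=` span L F.
Proof.
move=> x Fx; have [_ L1 _ _] := ringL.
by exists 1%N, (fun=> 1), (fun=> x); split=> //; rewrite big_ord1 mul1r.
Qed.

Lemma span_min F N : is_submodule L N -> F `<=` N -> span L F `<=` N.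
Proof.
move=> [N0 ND NZ] FN _ [n [c [s [Lc Fs ->]]]].
by apply: (big_ind N) => // i _; apply/NZ/FN.
Qed.

Lemma span_submodule F : is_submodule L (span L F).
Proof.
have [L0 L1 LD LM] := ringL; split.
- exists 0%N, (fun=> 0), (fun=> 0); split=> [[]//|[]//|].
  by rewrite big_ord0.
- move=> _ _ [m [c [s [Lc Fs ->]]]] [n [d [t [Ld Ft ->]]]].
  exists (m + n)%N.
  exists (fun i => match fintype.split i with inl j => c j | inr j => d j end).
  exists (fun i => match fintype.split i with inl j => s j | inr j => t j end).
  split=> [i|i|]; [by case: (fintype.split i)|by case: (fintype.split i)|].
  rewrite big_split_ord /=; congr (_ + _); apply: eq_bigr => i _.
    by rewrite -[lshift n i]/(unsplit (inl i)) unsplitK.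
  by rewrite -[rshift m i]/(unsplit (inr i)) unsplitK.
- move=> a _ La [n [c [s [Lc Fs ->]]]].
  exists n, (fun i => a * c i), s; split=> // [i|]; first exact: LM.
  by rewrite mulr_sumr; apply: eq_bigr => i _; rewrite mulrA.
Qed.

Lemma v_op_submodule I : is_submodule L (v_op L I).
Proof.
have [L0 L1 LD LM] := ringL; split=> [y _|x z Ix Iz y Iy|c x Lc Ix y Iy].
- by rewrite mul0r.
- by rewrite mulrDl; apply: LD; [exact: Ix|exact: Iz].
- by rewrite -mulrA; apply: LM => //; exact: Ix.
Qed.

Lemma v_op_span F : v_op L (span L F) = v_op L F.
Proof.
apply/seteqP; split; last exact/v_op_mono/sub_span.
apply: v_op_min; apply: span_min; first exact: v_op_submodule.
exact: sub_v_op.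
Qed.

Lemma nonzero_span F : nonzero (span L F) <-> nonzero F.
Proof.
split=> [[x Fx nzx]|[x Fx nzx]]; last by exists x => //; exact: sub_span.
apply: contrapT => nzF; move: nzx; suff -> : x = 0 by rewrite eqxx.
have FN : F `<=` [set 0].
  by move=> y Fy; apply: contrapT => y0; apply: nzF; exists y => //; exact/eqP.
apply: (@span_min F [set 0]) Fx => //; split=> //.
- by move=> _ _ -> ->; rewrite addr0.
- by move=> c _ _ ->; rewrite mulr0.
Qed.

(** Finite sets can replace finitely generated modules because a set and its span have the same
    v-closure, and a submodule contains one as soon as it contains the other. *)
Lemma t_opP N x : is_submodule L N ->
  t_op L N x <-> exists F, [/\ finite_set F, F `<=` N, nonzero F & v_op L F x].
Proof.
move=> modN; split.
  move=> [_ [[F finF ->] /nonzero_span nzF FN]]; rewrite v_op_span => Fx.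
  by exists F; split=> //; exact: subset_trans (@sub_span F) FN.
move=> [F [finF FN nzF Fx]]; exists (span L F); split.
- by exists F.
- exact/nonzero_span.
- exact: span_min.
- by rewrite v_op_span.
Qed.

Lemma sub_t_op I : is_submodule L I -> nonzero I -> I `<=` t_op L I.
Proof.
move=> modI [a Ia nza] x Ix; apply/t_opP => //.
(* As [x] may be 0, [a] keeps the set nonzero. *)
exists [set a; x]; split.
- by rewrite finite_setU; split; exact: finite_set1.
- by move=> _ [->|->].
- by exists a => //; left.
- by apply: sub_v_op; right.
Qed.

(** The definition only gives a finite [T] inside [span L I]. Each member of [T] is a combination of
    finitely many elements of [I]; together these elements form [F], whose v-closure contains [T]
    and hence [v_op L T]. *)
Lemma t_op_span_finite I x : t_op L (span L I) x ->
  exists F, [/\ finite_set F, F `<=` I & v_op L F x].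
Proof.
move/(t_opP _ (span_submodule I)) => [T [finT TI _ Tx]].
have [|s|F [finF FI TF]] :=
    @finite_subset_uniform K K T I (fun s F => v_op L F s) finT.
- by move=> s F F' FF'; exact: v_op_mono.
- move=> /TI [n [c [u [Lc Iu ->]]]].
  exists (range u); split; first exact: finite_image.
    by move=> _ [i _ <-].
  rewrite -v_op_span; apply: sub_v_op.
  by exists n, c, u; split=> // i; exists i.
- by exists F; split=> //; exact: v_op_min Tx.
Qed.

(** The module witnessing t-finiteness need not lie in the span of [I], but each of its generators
    lies in the t-closure of that span, hence in the v-closure of a finite subset of [I]. In the
    application [L] is a localization while [F] is still taken inside the original ideal. *)
Lemma t_finite_span I : nonzero I -> t_finite L (span L I) ->
  exists F, [/\ finite_set F, F `<=` I & I `<=` v_op L F].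
Proof.
move=> nzI [_ [[S finS ->] nzJ eqJ]].
have [|s Ss|F [finF FI SF]] :=
    @finite_subset_uniform K K S I (fun s F => v_op L F s) finS.
- by move=> s F F' FF'; exact: v_op_mono.
- apply: t_op_span_finite; rewrite -eqJ.
  by apply: sub_t_op => //; [exact: span_submodule|exact: sub_span].
exists F; split=> // x Ix.
have : t_op L (span L I) x.
  by apply: sub_t_op; [exact: span_submodule|exact/nonzero_span|exact: sub_span].
rewrite -eqJ => -[J [_ _ JS Jx]].
by apply: (v_op_min SF); rewrite -v_op_span; exact: v_op_mono Jx.
Qed.

Lemma v_op_sub_ring I : I `<=` L -> v_op L I `<=` L.
Proof.
have [_ L1 _ _] := ringL.
by move=> IL x Ix; rewrite -[x]mulr1; apply: Ix => y /IL; rewrite mul1r.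
Qed.

Lemma t_idealP N : is_submodule L N -> N `<=` L -> nonzero N ->
    (forall F x, finite_set F -> F `<=` N -> nonzero F -> v_op L F x -> N x) ->
  t_ideal L N.
Proof.
move=> modN NL nzN cN; have [N0 ND NZ] := modN; split=> //.
apply/seteqP; split; last exact: sub_t_op.
by move=> x /(t_opP _ modN)[F [finF FN nzF Fx]]; exact: cN Fx.
Qed.

Lemma t_ideal_submodule N : t_ideal L N -> is_submodule L N.
Proof. by move=> [[]]. Qed.

Lemma t_ideal_closed N F x : t_ideal L N ->
  finite_set F -> F `<=` N -> nonzero F -> v_op L F x -> N x.
Proof.
move=> tN finF FN nzF Fx; have modN := t_ideal_submodule tN.
by case: tN => _ _ <-; apply/t_opP => //; exists F.
Qed.

Lemma t_ideal_ring : t_ideal L L.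
Proof.
have [_ L1 _ _] := ringL; apply: t_idealP => //.
- exact: subring_submodule.
- by exists 1 => //; exact: oner_neq0.
- by move=> F x _ FL _; exact: v_op_sub_ring.
Qed.

(** Multiplication by [x] sends the v-closure of [F] into that of [x F], which stays in [N]. The
    case of [N] t-maximal yields primality; the case [N = L] gives the ideal of denominators of
    [x]. *)
Lemma colon_t_ideal N x d : t_ideal L N -> x != 0 ->
  L d -> d != 0 -> N (d * x) -> t_ideal L [set c | L c /\ N (c * x)].
Proof.
move=> tN nzx Ld nzd Ndx; have [N0 ND NZ] := t_ideal_submodule tN.
have [L0 L1 LD LM] := ringL; apply: t_idealP => //.
- split=> [|b c [Lb Nb] [Lc Nc]|b c Lb [Lc Nc]].
  + by split=> //; rewrite mul0r.
  + by split; [exact: LD|rewrite mulrDl; exact: ND].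
  + by split; [exact: LM|rewrite -mulrA; exact: NZ].
- by move=> c [].
- by exists d.
- move=> F c finF FC [f Ff nzf] Fc; split.
    by apply: v_op_sub_ring Fc => y /FC[].
  apply: (@t_ideal_closed N ((fun y => y * x) @` F)) => //.
  + exact: finite_image.
  + by move=> _ [y /FC[_ ?] <-].
  + by exists (f * x); [exists f|rewrite mulf_neq0].
  + by apply: v_opZ Fc => y Fy; exists y.
Qed.

Lemma proper_t_ideal N : t_ideal L N -> N <> L -> ~ N 1.
Proof.
move=> [[NL _ _ NZ] _ _] NnL N1; apply: NnL; apply/seteqP; split=> // x Lx.
by rewrite -[x]mulr1; exact: NZ.
Qed.

End DivisorialClosure.

(** * t-maximal ideals and localization at them *)

Section TMaximal.
Variables (K : fieldType) (D : set K).
Hypothesis ringD : is_subring D.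
Implicit Types M N F : set K.

(** Zorn's lemma for the t-ideals that contain [N] and omit 1. The union of a chain of these is
    again a t-ideal, since any finite subset of it lies in a single member. *)
Lemma t_maximal_exists N : t_ideal D N -> N <> D ->
  exists2 M, t_maximal D M & N `<=` M.
Proof.
move=> tN NnD.
pose good X := [/\ t_ideal D X, ~ X 1 & N `<=` X].
(* Zorn_bigcup also asks for the union of the empty chain *)
have [C CP totC|M [MP maxM]] := @Zorn_bigcup K (fun X => X = set0 \/ good X).
  have [[X0 CX0 goodX0]|nogood] := pselect (exists2 X, C X & good X); last first.
    left; apply/seteqP; split=> // x [X CX Xx].
    by have [X0|gX] := CP X CX; [rewrite X0 in Xx|apply: nogood; exists X].
  right; have [tX0 _ NX0] := goodX0.
  have chain F : F `<=` \bigcup_(X in C) X -> finite_set F ->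
      exists X, [/\ C X, F `<=` X & good X].
    move=> FC finF.
    (* Adding 0 to [F] forces the member found to be nonempty, which excludes the alternative
       [X = set0]. *)
    have [|||X CX FX] := @finite_sub_chain K C ([set 0] `|` F) totC.
    - by exists X0.
    - by rewrite finite_setU; split=> //; exact: finite_set1.
    - move=> x [->|/FC//]; exists X0 => //.
      by have [] := t_ideal_submodule tX0.
    exists X; split=> //; first by move=> x Fx; apply: FX; right.
    by have [X_0|//] := CP X CX; have := FX 0 (or_introl erefl); rewrite X_0.
  split.
  - apply: (t_idealP ringD).
    + split=> [|x y Cx Cy|c x Dc [X CX Xx]].
      * by exists X0 => //; have [] := t_ideal_submodule tX0.
      * have [||X [CX xyX [tX _ _]]] := chain [set x; y].
        - by move=> _ [->|->].
        - by rewrite finite_setU; split; exact: finite_set1.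
        exists X => //; have [_ XD _] := t_ideal_submodule tX.
        by apply: XD; apply: xyX; [left|right].
      * have [X_0|[tX _ _]] := CP X CX; first by rewrite X_0 in Xx.
        by exists X => //; have [_ _ XZ] := t_ideal_submodule tX; exact: XZ.
    + move=> x [X CX Xx]; have [X_0|[[[XD _ _ _] _ _] _ _]] := CP X CX.
        by rewrite X_0 in Xx.
      exact: XD.
    + by have [_ [a X0a nza] _] := tX0; exists a => //; exists X0.
    + move=> F x finF FC nzF Fx; have [X [CX FX [tX _ _]]] := chain F FC finF.
      by exists X => //; exact: (t_ideal_closed ringD tX) Fx.
  - move=> [X CX X1]; have [X_0|[_ nX1 _]] := CP X CX; last exact: nX1.
    by rewrite X_0 in X1.
  - by move=> x /NX0 X0x; exists X0.
have gN : good N by split=> //; exact: (proper_t_ideal tN).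
(* The empty set is not maximal: it is strictly contained in [N]. *)
have [M0|[tM nM1 NM]] := MP.
  have [_ [a Na _] _] := tN.
  case: (maxM N); last by right.
  rewrite M0 properEneq; split; last exact: sub0set.
  by apply/eqP => N0; rewrite -N0 in Na.
exists M => //; split=> // [MD|X tX XnD MX].
  by apply: nM1; rewrite MD; case: ringD.
apply: contrapT => XnM; apply: (maxM X).
  by rewrite properEneq; split=> //; apply/eqP => MX'; apply: XnM.
right; split=> //; first exact: (proper_t_ideal tX).
exact: subset_trans NM MX.
Qed.

(** If [b] is not in [M], the colon ideal of [M] by [b] is a proper t-ideal containing [M], so it
    equals [M] by maximality; and it contains [a]. *)
Lemma t_maximal_prime M a b : t_maximal D M -> D a -> D b -> M (a * b) ->
  M a \/ M b.
Proof.
move=> [tM MnD maxM] Da Db Mab; apply: contrapT => /not_orP[nMa nMb].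
have [M0 _ MZ] := t_ideal_submodule tM; have [[MD _ _ _] [m Mm nzm] _] := tM.
have nzb : b != 0 by apply/eqP => b0; apply: nMb; rewrite b0.
have colonM : [set c | D c /\ M (c * b)] = M.
  apply: maxM.
  - apply: (colon_t_ideal ringD tM nzb (MD _ Mm) nzm).
    by rewrite mulrC; exact: MZ.
  - move=> colonD; apply: nMb; rewrite -[b]mul1r.
    have [_ D1 _ _] := ringD; rewrite -colonD in D1.
    by case: D1.
  - by move=> c Mc; split; [exact: MD|rewrite mulrC; exact: MZ].
by apply: nMa; rewrite -colonM.
Qed.

Lemma t_maximal_not1 M : t_maximal D M -> ~ M 1.
Proof. by move=> [tM MnD _]; exact: (proper_t_ideal tM). Qed.

Lemma sub_localization M : ~ M 1 -> D `<=` localization D M.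
Proof.
have [_ D1 _ _] := ringD => nM1 x Dx.
by exists x, 1; split=> //; rewrite divr1.
Qed.

Lemma localization_subring M : t_maximal D M -> is_subring (localization D M).
Proof.
move=> maxM; have [D0 D1 DD DM] := ringD.
have nM1 := t_maximal_not1 maxM.
have primeM s t : D s -> D t -> ~ M s -> ~ M t -> ~ M (s * t).
  by move=> Ds Dt nMs nMt /(t_maximal_prime maxM Ds Dt)[].
have nz s : ~ M s -> s != 0.
  move=> nMs; apply/eqP => s0; apply: nMs; rewrite s0.
  by have [tM _ _] := maxM; have [] := t_ideal_submodule tM.
split; [exact: sub_localization|exact: sub_localization| |].
- move=> _ _ [a [s [Da Ds nMs ->]]] [b [t [Db Dt nMt ->]]].
  exists (a * t + b * s), (s * t).
  split; [by apply: DD; exact: DM|exact: DM|exact: primeM|].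
  by rewrite addf_div ?nz.
- move=> _ _ [a [s [Da Ds nMs ->]]] [b [t [Db Dt nMt ->]]].
  exists (a * b), (s * t); split; [exact: DM|exact: DM|exact: primeM|].
  by rewrite mulf_div.
Qed.

Hypothesis quotientD : forall x : K, exists d, [/\ D d, d != 0 & D (d * x)].

(** If [x] is not in [D], its denominators form a proper t-ideal, contained in some t-maximal [M].
    Writing [x = a / s] in the localization at [M] gives a denominator [s] outside [M], a
    contradiction. *)
Lemma sub_localizations x :
  (forall M, t_maximal D M -> localization D M x) -> D x.
Proof.
move=> locx; have [D0 D1 _ _] := ringD; apply: contrapT => nDx.
have nzx : x != 0 by apply/eqP => x0; apply: nDx; rewrite x0.
have [d [Dd nzd Ddx]] := quotientD x.
have [||M maxM colonM] := @t_maximal_exists [set c | D c /\ D (c * x)].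
- exact: (colon_t_ideal ringD (t_ideal_ring ringD) nzx Dd nzd Ddx).
- by move=> colonD; apply: nDx; rewrite -colonD in D1; case: D1; rewrite mul1r.
have [a [s [Da Ds nMs xE]]] := locx M maxM.
apply: nMs; apply: colonM; split=> //; rewrite xE mulrC divfK //.
by apply/eqP => s0; move: nzx; rewrite xE s0 invr0 mulr0 eqxx.
Qed.

Lemma t_finite_of_t_local I : t_finite_character D -> t_ideal D I ->
  t_locally_t_finite D I -> t_finite D I.
Proof.
move=> finD tI locI; have modI := t_ideal_submodule tI.
have [[ID _ _ _] [a Ia nza] tII] := tI.
have [||M [maxM Ma]|F [finF FI FM]] :=
  @finite_subset_uniform _ K [set M | t_maximal D M /\ M a] I
    (fun M F => I `<=` v_op (localization D M) F).
- by apply: finD => //; exact: ID.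
- by move=> M F F' FF' IF; apply: subset_trans IF _; exact: v_op_mono.
- apply: t_finite_span; [exact: localization_subring|by exists a|exact: locI].
pose Fa := [set a] `|` F; exists (span D Fa).
have FaI : Fa `<=` I by move=> x [->|/FI].
have JI : span D Fa `<=` I by apply: span_min.
have nzFa : nonzero Fa by exists a => //; left.
have finFa : finite_set Fa.
  by rewrite finite_setU; split=> //; exact: finite_set1.
split; [by exists Fa|exact/nonzero_span|].
apply/seteqP; split; first exact: t_op_mono.
rewrite tII => x Ix; apply/(t_opP _ _ (span_submodule ringD Fa)) => //.
exists Fa; split=> //; first exact: sub_span.
(* Here [y] multiplies [Fa] into [D], and the goal [D (x * y)] is checked at each t-maximal
   ideal. *)
move=> y Fy; apply: sub_localizations => M maxM.
have DM := sub_localization (t_maximal_not1 maxM).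
have [Ma|nMa] := pselect (M a).
  apply: (FM M) => // z Fz; apply: DM; apply: Fy; by right.
exists (x * (y * a)), a; split=> //.
- by have [_ _ _ DMul] := ringD; apply: DMul; [exact: ID|apply: Fy; left].
- exact: ID.
- by rewrite mulrA mulfK.
Qed.

End TMaximal.

(** * The fraction field of an integral domain *)

Lemma in_frac_subring (A : idomainType) : is_subring (in_frac A).
Proof.
split; [by exists 0; rewrite ?rmorph0|by exists 1; rewrite ?rmorph1| |].
- by move=> _ _ [a _ <-] [b _ <-]; exists (a + b); rewrite ?rmorphD.
- by move=> _ _ [a _ <-] [b _ <-]; exists (a * b); rewrite ?rmorphM.
Qed.

Lemma in_frac_denominator (A : idomainType) (x : {fraction A}) :
  exists d, [/\ in_frac A d, d != 0 & in_frac A (d * x)].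
Proof.
elim/quotW: x => r; exists (tofrac \d_r); split; first by exists \d_r.
  by rewrite tofrac_eq0 denom_ratioP.
have nzd := denom_ratioP r.
(* With [n / d] the representative of [x], the equality of classes reduces to the equivalence of the
   ratios [n / 1] and [(d n) / d]. *)
exists \n_r => //; unlock tofrac; rewrite -[RHS]FracField.pi_mul.
rewrite /FracField.mulf /= !numden_Ratio ?oner_eq0 // mul1r.
apply/eqmodP; rewrite /= FracField.equivfE !numden_Ratio ?oner_eq0 //.
by rewrite mul1r mulrC.
Qed.

Theorem theorem1p9 (A : idomainType) (I : set {fraction A}) :
  t_finite_character (in_frac A) ->
  t_ideal (in_frac A) I ->
  t_locally_t_finite (in_frac A) I ->
  t_finite (in_frac A) I.
Proof.
exact: (t_finite_of_t_local (in_frac_subring A) (@in_frac_denominator A)).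
Qed.
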